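(* For all integers $k \geq 1$ and $n \geq 1$, $$2^{2k} S_{2k}(n) = \sum_{m=1}^k R(k,m) \binom{2n+m+1}{2m+1}.$$
   Context: For integers $k, n\ge 1$, $S_k(n) = 1^k + 2^k + \cdots + n^k$. For integers $0 \le m \le k$, the numbers $R(k,m)$ (OEIS A304330) are defined by $$R(k,m) = \sum_{j=0}^m (-1)^j \binom{2m}{j} (m-j)^{2k},$$ with the convention $0^0=1$. Binomial coefficients $\binom{a}{b}$ with integers $0\le a<b$ are $0$. *)

(* Defs.v *)
From HB Require Import structures.
From mathcomp Require Import all_boot all_order all_algebra.
Set Implicit Arguments. Unset Strict Implicit. Unset Printing Implicit Defensive.
Import Order.TTheory GRing.Theory Num.Theory.
Local Open Scope ring_scope.

Definition power_sum (k n : nat) : int := \sum_(1 <= i < n.+1) i%:Z ^+ k.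

(* OEIS A304330. The formula makes sense for all k and m;
   the triangle proper is the range m <= k. Since x ^+ 0 = 1 for every x, the
   term j = m follows the convention 0 ^ 0 = 1 when k = 0. *)
Definition central_R (k m : nat) : int :=
  \sum_(0 <= j < m.+1)
    (-1) ^+ j * 'C(2 * m, j)%:Z * (m%:Z - j%:Z) ^+ (2 * k).

(* Main.v *)
Require Import Defs.
From HB Require Import structures.
From mathcomp Require Import all_boot all_order all_algebra.
From mathcomp Require Import zify ring lra.
Set Implicit Arguments. Unset Strict Implicit. Unset Printing Implicit Defensive.
Import Order.TTheory GRing.Theory Num.Theory.
Local Open Scope ring_scope.

(** The identity expands [x ^ 2k] in a basis of even central factorials and
    then sums that basis in closed form.

    Write [B_m(x) = C(x + m, 2m) + C(x + m - 1, 2m)], which is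
    [2 / (2m)!] times the central factorial
    [x^2 (x^2 - 1) ... (x^2 - (m - 1)^2)].  Passing from [m] to [m + 1]
    multiplies that product by [x^2 - m^2], so
    [x^2 B_m = m^2 B_m + (2m + 2)(2m + 1) B_(m+1)]
    ([sqr_mul_central_basis]).  The numbers [R(k, m)] satisfy the transposed
    recurrence ([central_R_rec]), and they vanish for [m > k >= 1]
    ([central_R_gt]); hence by induction on [k >= 1]
    [x ^ 2k = \sum_(1 <= m <= k) R(k, m) B_m(x)] ([expr_central_basis]).

    Taking [x = 2i] and summing over [i], Pascal's rule applied twice gives
    [B_m(2i) = C(2i + m + 1, 2m + 1) - C(2i + m - 1, 2m + 1)], which telescopes
    because [2i] moves in steps of two ([sum_central_basis]); the lower end
    [C(m + 1, 2m + 1)] is zero for [m >= 1]. *)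

(** * Binomial identities over the integers *)

Lemma bin_absorbz (n r : nat) :
  r.+1%:Z * 'C(n.+1, r.+1)%:Z = n.+1%:Z * 'C(n, r)%:Z.
Proof. by rewrite -!PoszM mul_bin_diag. Qed.

(** The truncated factor [n - r] of the natural-number identity can be
    replaced by the true difference, since ['C(n, r) = 0] when [n < r]. *)
Lemma bin_upz (n r : nat) :
  r.+1%:Z * 'C(n, r.+1)%:Z = (n%:Z - r%:Z) * 'C(n, r)%:Z.
Proof.
have [le_rn | lt_nr] := leqP r n; last by rewrite !bin_small ?mulr0 // ltnW.
by rewrite subzn // -!PoszM mul_bin_left.
Qed.

(** Pascal's rule makes the partial sums of an alternating row telescope. *)
Lemma alt_bin_partial_sum (n m : nat) :
  \sum_(0 <= j < m.+1) (-1) ^+ j * 'C(n.+1, j)%:Z = (-1) ^+ m * 'C(n, m)%:Z.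
Proof.
elim: m => [|m IHm]; first by rewrite big_nat1 !bin0.
by rewrite big_nat_recr //= IHm binS PoszD exprS; ring.
Qed.

(** * The numbers R(k, m) *)

(** Split [(m+1-j)^2 = (m+1)^2 - j (2m+2-j)]: the factor [j (2m+2-j)] is
    absorbed by the binomial coefficient, which becomes
    [(2m+2)(2m+1) C(2m, j-1)], and shifting [j] gives [R(k, m)]. *)
Lemma central_R_rec (k m : nat) :
  central_R k.+1 m.+1 = m.+1%:Z ^+ 2 * central_R k m.+1
    + (2 * m%:Z + 2) * (2 * m%:Z + 1) * central_R k m.
Proof.
have absorb2 j : j.+1%:Z * (2 * m%:Z + 1 - j%:Z) * 'C(2 + 2 * m, j.+1)%:Z
    = (2 * m%:Z + 2) * (2 * m%:Z + 1) * 'C(2 * m, j)%:Z.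
  have E1 : j.+1%:Z * 'C(2 + 2 * m, j.+1)%:Z
      = (2 * m%:Z + 2) * 'C((2 * m).+1, j)%:Z.
    by rewrite (bin_absorbz (2 * m).+1 j); congr (_ * _); lia.
  have E2 := bin_absorbz (2 * m) j.
  have E3 := bin_upz (2 * m).+1 j.
  rewrite [LHS]mulrAC E1 -[LHS]mulrA -[RHS]mulrA; congr (_ * _).
  have -> : 2 * m%:Z + 1 = (2 * m).+1%:Z by lia.
  by rewrite mulrC -E3 E2.
rewrite /central_R mulnS !mulr_sumr big_nat_recl // [in RHS]big_nat_recl //=.
rewrite -addrA -big_split /= mulnS !exprD.
congr (_ + _); first by rewrite !bin0 subr0; ring.
apply: eq_bigr => j _.
rewrite exprD.
have -> : m.+1%:Z - j.+1%:Z = m%:Z - j%:Z by lia.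
set P := _ ^+ (2 * k).
transitivity (m.+1%:Z ^+ 2 * ((-1) ^+ j.+1 * 'C(2 + 2 * m, j.+1)%:Z * P)
  + (-1) ^+ j * P * (j.+1%:Z * (2 * m%:Z + 1 - j%:Z)
                     * 'C(2 + 2 * m, j.+1)%:Z)).
  by rewrite exprS !intS; ring.
by rewrite absorb2; ring.
Qed.

Lemma central_R_0r (k : nat) : central_R k.+1 0 = 0.
Proof. by rewrite /central_R big_nat1 subrr mulnS addSn exprS mul0r mulr0. Qed.

Lemma central_R_0l (m : nat) :
  central_R 0 m.+1 = (-1) ^+ m.+1 * 'C((2 * m).+1, m.+1)%:Z.
Proof.
rewrite -alt_bin_partial_sum /central_R mulnS.
by apply: eq_bigr => j _; rewrite muln0 expr0 mulr1.
Qed.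

(** The row [k = 0] does not vanish beyond the diagonal, so the induction
    starts at [k = 1], where the two terms of the recurrence cancel. *)
Lemma central_R_gt (k m : nat) : (k < m)%N -> central_R k.+1 m.+1 = 0.
Proof.
elim: k m => [|k IHk] [//|m] lt_km.
  rewrite central_R_rec !central_R_0l.
  have E1 := bin_absorbz (2 * m.+1) m.+1.
  have E2 := bin_absorbz (2 * m).+1 m.
  have E3 := bin_upz (2 * m).+1 m.
  rewrite (_ : (2 * m.+1)%N = (2 * m).+2) in E1 *; last by lia.
  set c := 'C((2 * m).+3, m.+2)%:Z in E1 *.
  set d := 'C((2 * m).+2, m.+1)%:Z in E1 E2 *.
  set a := 'C((2 * m).+1, m)%:Z in E2 E3 *.
  set b := 'C((2 * m).+1, m.+1)%:Z in E3 *.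
  (* a and b are the two middle entries of row 2m+1, and d is their sum. *)
  have eab : a = b by nia.
  have ed : d = 2 * b by nia.
  have key : (m%:Z + 2) * c = (2 * (2 * m%:Z + 3)) * b.
    transitivity (m.+2%:Z * c); first by congr (_ * _); lia.
    by rewrite E1 ed mulrA; congr (_ * _); lia.
  transitivity ((-1) ^+ m * (m%:Z + 2)
     * ((m%:Z + 2) * c - 2 * (2 * m%:Z + 3) * b)).
    by rewrite !exprS -(addn1 m.+1) -(addn1 m) !PoszD; ring.
  by rewrite key subrr mulr0.
by rewrite central_R_rec !IHk ?mulr0 ?addr0 //; lia.
Qed.

(** * The central factorial basis *)

(** For [x > 0] this is [2 / (2m)! * x^2 (x^2 - 1) ... (x^2 - (m-1)^2)]. *)
Definition central_basis (x m : nat) : int :=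
  'C(x + m, 2 * m)%:Z + 'C((x + m).-1, 2 * m)%:Z.

(** Both [(x^2 - m^2) B_m] and [(2m+2)(2m+1) B_(m+1)] are equal to
    [2x (2m+1) C(x+m, 2m+1)]: the two terms of [B_m] contribute in the
    proportion [(x + m) : (x - m)], and those of [B_(m+1)] in the proportion
    [(x + m + 1) : (x - m - 1)]. *)
Lemma sqr_mul_central_basis (x m : nat) : (0 < x)%N ->
  x%:Z ^+ 2 * central_basis x m = m%:Z ^+ 2 * central_basis x m
    + (2 * m%:Z + 2) * (2 * m%:Z + 1) * central_basis x m.+1.
Proof.
case: x => // x _; rewrite /central_basis addnS !addSn /= mulnS.
have E1 := bin_absorbz (x + m) (2 * m).
have E2 := bin_upz (x + m).+1 (2 * m).
have E3 := bin_absorbz (x + m).+1 (2 * m).+1.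
have E4 := bin_upz (x + m).+1 (2 * m).+1.
rewrite add2n; move: E1 E2 E3 E4.
move: ('C(x + m, 2 * m)%:Z) ('C((x + m).+1, 2 * m)%:Z) => a b.
move: ('C((x + m).+1, (2 * m).+1)%:Z) ('C((x + m).+2, (2 * m).+2)%:Z) => c d.
move: ('C((x + m).+1, (2 * m).+2)%:Z) => e.
rewrite !intS PoszD PoszM.
move: x%:Z m%:Z => X M E1 E2 E3 E4.
have E1' := congr1 ( *%R (1 + X - M)) E1.
have E2' := congr1 ( *%R (1 + X + M)) E2.
have E3' := congr1 ( *%R (2 * M + 1)) E3.
have E4' := congr1 ( *%R (2 * M + 1)) E4.
lra.
Qed.

(** The coefficients of [x ^ 2k] in the basis follow the transposed
    recurrence; the boundary terms [R(k, 0)] and [R(k, k + 1)] vanish. *)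
Lemma expr_central_basis (k x : nat) : (0 < x)%N ->
  x%:Z ^+ (2 * k.+1) =
  \sum_(1 <= m < k.+2) central_R k.+1 m * central_basis x m.
Proof.
move=> x_gt0; elim: k => [|k IHk].
  have R11 : central_R 1 1 = 1 by rewrite /central_R unlock.
  rewrite big_nat1 R11 mul1r muln1 /central_basis addn1 /=.
  have := bin_absorbz x 1; have := bin_upz x 1; rewrite bin1 !intS.
  by move: x%:Z ('C(x, 2)%:Z) ('C(x.+1, 2)%:Z) => X a b; lra.
rewrite mulnS exprD {}IHk mulr_sumr.
transitivity (\sum_(1 <= m < k.+2)
    (m%:Z ^+ 2 * central_R k.+1 m * central_basis x m)
  + \sum_(1 <= m < k.+2) ((2 * m%:Z + 2) * (2 * m%:Z + 1) * central_R k.+1 m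
                            * central_basis x m.+1)).
  rewrite -big_split /=; apply: eq_bigr => m _.
  by rewrite mulrCA sqr_mul_central_basis //; ring.
transitivity (\sum_(1 <= m < k.+3)
    (m%:Z ^+ 2 * central_R k.+1 m * central_basis x m)
  + \sum_(0 <= m < k.+2) ((2 * m%:Z + 2) * (2 * m%:Z + 1) * central_R k.+1 m
                            * central_basis x m.+1)).
  rewrite [in RHS]big_nat_recr //= central_R_gt // mulr0 mul0r addr0.
  by congr (_ + _); rewrite [in RHS]big_ltn // central_R_0r mulr0 mul0r add0r.
rewrite !(big_add1, big_add1) /= -big_split /=; apply: eq_bigr => m _.
by rewrite (central_R_rec k.+1); ring.
Qed.

Lemma sum_central_basis (n m : nat) : (0 < m)%N ->
  \sum_(1 <= i < n.+1) central_basis (2 * i) m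
    = 'C(2 * n + m + 1, 2 * m + 1)%:Z.
Proof.
move=> m_gt0; elim: n => [|n IHn].
  by rewrite big_geq // bin_small //; lia.
rewrite big_nat_recr //= IHn /central_basis mulnS !addn1 !addSn add0n /=.
by rewrite [in RHS]binS [in X in _ = X]binS !PoszD; ring.
Qed.

Theorem theorem1 (k n : nat) (hk : (1 <= k)%N) (hn : (1 <= n)%N) :
  2%:Z ^+ (2 * k) * power_sum (2 * k) n =
  \sum_(1 <= m < k.+1) central_R k m * 'C(2 * n + m + 1, 2 * m + 1)%:Z.
Proof.
case: k hk => // k _; rewrite /power_sum mulr_sumr.
transitivity (\sum_(1 <= i < n.+1) \sum_(1 <= m < k.+2)
    central_R k.+1 m * central_basis (2 * i) m).
  apply: eq_big_nat => i /andP[i_gt0 _].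
  by rewrite -exprMn -PoszM expr_central_basis // muln_gt0.
rewrite exchange_big /=; apply: eq_big_nat => m /andP[m_gt0 _].
by rewrite -mulr_sumr sum_central_basis.
Qed.
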